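(* For every $n>0$, the $F$-triangle $F_n(x,y)$ associated with the Hochschild lattice $\mathrm{Hoch}(n)$ satisfies $$F_n(x,y)=\sum_{(u,A)}x^{\,n-|A|-\widetilde{\mathrm{neg}}(u,A)}\,y^{\,\widetilde{\mathrm{neg}}(u,A)},$$ where the sum runs over all pairs $(u,A)$ with $u\in\mathrm{Tri}(n)$ and $A$ a subset of the set $\mathrm{Cov}_\downarrow(u)$ of elements covered by $u$ in $\mathrm{Hoch}(n)$.
   Context: Hochschild lattice. For $n\geq 1$, a triword of length $n$ is a tuple $u=(u_1,\ldots,u_n)$ such that (T1) $u_i\in\{0,1,2\}$ for all $i$; (T2) $u_1\neq 2$; (T3) if $u_i=0$, then $u_j\neq 1$ for all $j>i$. Let $\mathrm{Tri}(n)$ be the set of all triwords of length $n$. The Hochschild lattice is $\mathrm{Hoch}(n)=(\mathrm{Tri}(n),\leq)$ where $\leq$ is the componentwise order. It is known to be a semidistributive lattice: the join is the componentwise maximum, and the meet is obtained by taking the componentwise minimum and then replacing by $0$ every entry $1$ that has an entry $0$ somewhere to its left. Labels and core label order. Let $L$ be a finite semidistributive lattice. For a cover relation $a\lessdot b$ put $\lambda(a,b)=\min\{c\in L\mid a\vee c=b\}$; this minimum exists and is join irreducible. The canonical join representation of $a\in L$ is $\mathrm{Can}(a)=\{\lambda(b,a)\mid b\lessdot a\}$, and $b\mapsto\lambda(b,a)$ is a bijection from $\mathrm{Cov}_\downarrow(a)=\{b\in L\mid b\lessdot a\}$ to $\mathrm{Can}(a)$. The nucleus of $a$ is $a_\downarrow=a\wedge\bigwedge_{b\lessdot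 a}b$. The core label set of $a$ is $\Psi(a)=\{\lambda(b,b')\mid a_\downarrow\leq b\lessdot b'\leq a\}$. The map $a\mapsto\Psi(a)$ is injective. The core label order $\mathrm{CLO}(L)$ is the poset $(L,\sqsubseteq)$ where $a\sqsubseteq b$ if and only if $\Psi(a)\subseteq\Psi(b)$. $F$-triangle. The poset $\mathrm{CLO}(\mathrm{Hoch}(n))$ is graded with least element $(0,\ldots,0)$; let $\mathrm{rk}$ be its rank function (so $\mathrm{rk}(0,\ldots,0)=0$) and $\mu_n$ its Möbius function (with $\mu_n(u,v)=0$ if $u\not\sqsubseteq v$). Define $$M_n(x,y)=\sum_{u,v\in\mathrm{Tri}(n)}\mu_n(u,v)\,x^{\mathrm{rk}(u)}y^{\mathrm{rk}(v)},\qquad F_n(x,y)=y^n M_n\left(\frac{y+1}{y-x},\frac{y-x}{y}\right).$$ The statistic. Let $\mathrm{Atom}(n)$ be the set of atoms of $\mathrm{Hoch}(n)$: $(1,0,\ldots,0)$ and, for $2\leq i\leq n$, the tuple with a $2$ in position $i$ and zeros elsewhere. Put $\mathrm{neg}(u)=|\mathrm{Can}(u)\cap\mathrm{Atom}(n)|$ and, for $A\subseteq\mathrm{Cov}_\downarrow(u)$, $$\widetilde{\mathrm{neg}}(u,A)=\mathrm{neg}(u)-\bigl|\{u'\in A\mid\lambda(u',u)\in\mathrm{Atom}(n)\}\bigr|.$$ The pair $(u,A)$ represents the partial core of $u$ with respect to $A$, i.e. the interval $[u\wedge\bigwedge_{u'\in A}u',\,u]$ of $\mathrm{Hoch}(n)$.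 *)

(* Defs.v *)
From HB Require Import structures.
From mathcomp Require Import all_boot all_order all_algebra.
From mathcomp Require Import fraction.
From mathcomp Require Import mpoly.

Set Implicit Arguments.
Unset Strict Implicit.
Unset Printing Implicit Defensive.

Import Order.TTheory GRing.Theory Num.Theory.

Local Open Scope order_scope.

Section FinPOrder.
Context {d : Order.disp_t} {P : finPOrderType d}.
Implicit Types (x y : P) (C : {set P}).

Definition covers x y : bool := (x < y) && ~~ [exists z, x < z < y].

Definition is_chain C : bool := [forall x in C, forall y in C, x >=< y].

(* The length (number of steps) of a longest chain with greatest element x. In
   a graded poset with a least element this is the value at x of the rank
   function normalized to be 0 at the least element. *)
Definition rank x : nat :=
  (\max_(C : {set P} | [&& is_chain C, x \in C & [forall y in C, (y <= x)%O]])
     #|C|.-1)%N.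

(* mu x x = 1, mu x y = - \sum_(x <= z < y) mu x z if x < y, and mu x y = 0
   otherwise; k bounds the depth of the recursion. *)
Fixpoint mobius_rec (k : nat) (x y : P) : int :=
  if x == y then 1%R
  else if k is k'.+1 then
    if x < y then (- \sum_(z : P | (x <= z < y)%O) mobius_rec k' x z)%R else 0%R
  else 0%R.

(* The fuel #|P| suffices, since chains have at most #|P| elements. *)
Definition mobius x y : int := mobius_rec #|P| x y.

End FinPOrder.

HB.mixin Record Lattice_isSemidistributive d (L : Type)
    of Order.FinLattice d L := {
  join_semidistributive : forall a b c : L,
    a `|` b = a `|` c -> a `|` (b `&` c) = a `|` b;
  meet_semidistributive : forall a b c : L,
    a `&` b = a `&` c -> a `&` (b `|` c) = a `&` b
}.

#[short(type="finSemidistrLatticeType")]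
HB.structure Definition FinSemidistrLattice d :=
  { L of Order.FinLattice d L & Lattice_isSemidistributive d L }.

Section Labels.
Context {d : Order.disp_t} {L : finSemidistrLatticeType d}.
Implicit Types a b c : L.

Definition is_label a b c : bool :=
  (a `|` c == b) && [forall c', (a `|` c' == b) ==> (c <= c')].

(* min {c | a \/ c = b}; by is_labelP the default value b is never used when
   a <= b. *)
Definition label a b : L := odflt b [pick c | is_label a b c].

Definition lower_covers a : {set L} := [set b | covers b a].

Definition Can a : {set L} := [set label b a | b in lower_covers a].

Definition nucleus a : L := a `&` \big[Order.meet/a]_(b in lower_covers a) b.

Definition core_labels a : {set L} :=
  [set label p.1 p.2 |
    p : L * L & [&& nucleus a <= p.1, covers p.1 p.2 & p.2 <= a]].

Lemma is_labelP a b : a <= b -> is_label a b (label a b).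
Proof.
move=> le_ab; rewrite /label; case: pickP => [//|no].
pose m := \big[Order.meet/b]_(c in [set c | a `|` c == b]) c.
have amb : a `|` m = b.
  apply: (big_ind (fun c => a `|` c = b)) => [|x y ax ay|c].
  - exact: join_r.
  - by rewrite join_semidistributive ?ax ?ay.
  - by rewrite inE => /eqP.
move: (no m); rewrite /is_label amb eqxx /=.
suff -> : [forall c', (a `|` c' == b) ==> (m <= c')] by [].
apply/forallP => c; apply/implyP => ac.
by rewrite /m (bigD1 c) ?inE //= leIl.
Qed.

Lemma exists_lower_cover a b : b < a -> exists2 c, covers c a & b <= c.
Proof.
have [k] := ubnP #|[set z | b < z < a]|; elim: k b => // k IH b lek lt_ba.
have [|/negP no] := boolP [exists z, b < z < a]; last first.
  by exists b; rewrite // /covers lt_ba /=; apply/negP.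
case/existsP => z /andP[bz za].
have [|//|c ca zc] := IH z; last by exists c => //; apply: le_trans (ltW bz) zc.
rewrite ltnS in lek; apply: leq_trans lek; apply: proper_card; apply/properP; split.
  by apply/subsetP => t; rewrite !inE => /andP[zt ->]; rewrite (lt_trans bz zt).
by exists z; rewrite !inE ?bz ?za // ltxx.
Qed.

Lemma core_labels_le a c : c \in core_labels a -> c <= a.
Proof.
case/imsetP=> -[p q] /=; rewrite inE /= => /and3P[_ /andP[pq _] qa] ->.
have /andP[/eqP le _] := is_labelP (ltW pq).
by apply: le_trans qa; rewrite -{2}le leUr.
Qed.

Lemma core_labels_inj : injective core_labels.
Proof.
suff le a b : core_labels a = core_labels b -> a <= b.
  by move=> a b E; apply: le_anti; rewrite !le.
move=> E; have: a `&` b <= a by rewrite leIl.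
rewrite le_eqVlt => /orP[/eqP <-|]; first by rewrite leIr.
case/exists_lower_cover => c ca abc.
have lac : label c a \in core_labels a.
  apply/imsetP; exists (c, a) => //; rewrite inE /= ca lexx andbT /=.
  by rewrite /nucleus leIx2 // (bigD1 c) ?inE //= leIl orbT.
have lb : label c a <= b by apply: core_labels_le; rewrite -E.
have lc : label c a <= c.
  by apply: le_trans abc; rewrite lexI lb core_labels_le.
have /andP[lt_ca _] := ca.
have /andP[/eqP] := is_labelP (ltW lt_ca).
by rewrite (join_l lc) => ca' _; move: lt_ca; rewrite ca' ltxx.
Qed.

End Labels.

Definition CLO {d} (L : finSemidistrLatticeType d) : Type := L.

Fact CLO_display : Order.disp_t -> Order.disp_t.
Proof. by []. Qed.

Section CoreLabelOrder.
Context {d : Order.disp_t} (L : finSemidistrLatticeType d).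
Local Notation T := (CLO L).

HB.instance Definition _ := Finite.on T.

Definition clo_le : rel T :=
  fun a b => core_labels (a : L) \subset core_labels (b : L).

Fact clo_le_refl : reflexive clo_le.
Proof. by move=> a; apply: subxx. Qed.

Fact clo_le_anti : antisymmetric clo_le.
Proof. by move=> a b H; apply/core_labels_inj/eqP; rewrite eqEsubset. Qed.

Fact clo_le_trans : transitive clo_le.
Proof. by move=> b a c; apply: subset_trans. Qed.

HB.instance Definition _ := Order.Le_isPOrder.Build (CLO_display d) T
  clo_le_refl clo_le_anti clo_le_trans.

End CoreLabelOrder.

Section Triwords.
Variable n : nat.

(* Positions are numbered from 0, so u_1 in (T2) is the entry at position 0. *)
Definition is_triword (u : {ffun 'I_n -> 'I_3}) : bool :=
  [forall i : 'I_n, (i == 0 :> nat) ==> (u i != 2 :> nat)] &&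
  [forall i : 'I_n, forall j : 'I_n,
     (i < j)%N ==> (u i == 0 :> nat) ==> (u j != 1 :> nat)].

Record triword := Triword {
  triword_val :> {ffun 'I_n -> 'I_3};
  _ : is_triword triword_val
}.

HB.instance Definition _ := [isSub for triword_val].
HB.instance Definition _ := [Finite of triword by <:].

Implicit Types u v w : triword.

Lemma triwordP (f : {ffun 'I_n -> 'I_3}) :
  reflect ((forall i : 'I_n, i = 0 :> nat -> f i <> 2 :> nat) /\
           (forall i j : 'I_n, (i < j)%N -> f i = 0 :> nat -> f j <> 1 :> nat))
          (is_triword f).
Proof.
apply: (iffP andP) => [[/forallP H2 /forallP H3]|[H2 H3]]; split.
- by move=> i i0; move/implyP: (H2 i); rewrite i0 => /(_ isT)/eqP.
- move=> i j ij fi; move/forallP: (H3 i) => /(_ j); rewrite ij fi eqxx /=.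
  by move/eqP.
- by apply/forallP=> i; apply/implyP => /eqP i0; apply/eqP/H2.
- apply/forallP=> i; apply/forallP => j; apply/implyP => ij.
  by apply/implyP => /eqP fi; apply/eqP; apply: H3 ij fi.
Qed.

Lemma triword_T2 u (i : 'I_n) : i = 0 :> nat -> u i <> 2 :> nat.
Proof. by case: u => f /= /triwordP[H _]; apply: H. Qed.

Lemma triword_T3 u (i j : 'I_n) :
  (i < j)%N -> u i = 0 :> nat -> u j <> 1 :> nat.
Proof. by case: u => f /= /triwordP[_ H]; apply: H. Qed.

Lemma triword_inj u v : (forall i, u i = v i :> nat) -> u = v.
Proof. by move=> E; apply/val_inj/ffunP => i; apply/val_inj/E. Qed.

Definition hoch_le : rel triword := fun u v => [forall i, (u i <= v i)%N].

Fact hoch_le_refl : reflexive hoch_le.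
Proof. by move=> u; apply/forallP. Qed.

Fact hoch_le_anti : antisymmetric hoch_le.
Proof.
move=> u v /andP[/forallP uv /forallP vu]; apply: triword_inj => i.
by apply/eqP; rewrite eqn_leq uv vu.
Qed.

Fact hoch_le_trans : transitive hoch_le.
Proof.
move=> v u w /forallP uv /forallP vw; apply/forallP => i.
exact: leq_trans (uv i) (vw i).
Qed.

Fact hoch_display : Order.disp_t.
Proof. exact: (Order.Disp tt tt). Qed.

HB.instance Definition _ := Order.Le_isPOrder.Build hoch_display triword
  hoch_le_refl hoch_le_anti hoch_le_trans.

Lemma hoch_leP u v : reflect (forall i, (u i <= v i)%N) (u <= v).
Proof. exact: forallP. Qed.

Definition max_word u v : {ffun 'I_n -> 'I_3} := [ffun i => Order.max (u i) (v i)].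

Definition min_word u v : {ffun 'I_n -> 'I_3} := [ffun i => Order.min (u i) (v i)].

(* Replace by 0 every entry 1 that has an entry 0 somewhere to its left. *)
Definition fix_word (f : {ffun 'I_n -> 'I_3}) : {ffun 'I_n -> 'I_3} :=
  [ffun i => if (f i == 1 :> nat) && [exists j : 'I_n, (j < i)%N && (f j == 0 :> nat)]
             then ord0 else f i].

Lemma max_wordE u v i : max_word u v i = maxn (u i) (v i) :> nat.
Proof.
by rewrite ffunE maxEle leEord; case: leqP => // /ltnW; case: maxnP.
Qed.

Lemma min_wordE u v i : min_word u v i = minn (u i) (v i) :> nat.
Proof. by rewrite ffunE minEle leEord; case: leqP. Qed.

Fact max_word_subproof u v : is_triword (max_word u v).
Proof.
apply/triwordP; split=> [i i0|i j ij]; rewrite !max_wordE.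
  move: (triword_T2 (u := u) i0) (triword_T2 (u := v) i0).
  by rewrite /maxn; case: ifP.
move=> /eqP; rewrite -leqn0 geq_max !leqn0 => /andP[/eqP ui /eqP vi].
move: (triword_T3 ij ui) (triword_T3 ij vi).
by rewrite /maxn; case: ifP.
Qed.

Fact fix_min_word_subproof u v : is_triword (fix_word (min_word u v)).
Proof.
apply/triwordP; split=> [i i0|i j ij].
  rewrite ffunE; case: ifP => // _; rewrite min_wordE.
  move: (triword_T2 (u := u) i0) (triword_T2 (u := v) i0).
  by rewrite /minn; case: ifP.
rewrite [fix_word _ j]ffunE; set f := min_word u v => fi0.
have [//|/=] := ifP; move=> no fj; move: no; rewrite fj eqxx /=.
suff -> : [exists k : 'I_n, (k < j)%N && (f k == 0 :> nat)] by [].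
move: fi0; rewrite ffunE; case: ifP => [/andP[_ /existsP[k /andP[ki fk]]] _|_ fi].
  by apply/existsP; exists k; rewrite (ltn_trans ki ij).
by apply/existsP; exists i; rewrite ij fi.
Qed.

Definition hoch_join u v : triword := Triword (max_word_subproof u v).
Definition hoch_meet u v : triword := Triword (fix_min_word_subproof u v).

Fact hoch_lexI u v w : (u <= hoch_meet v w) = (u <= v) && (u <= w).
Proof.
apply/hoch_leP/andP => [H|[/hoch_leP uv /hoch_leP uw] i].
  have H' i : (u i <= minn (v i) (w i))%N.
    apply: leq_trans (H i) _; rewrite -min_wordE /= [fix_word _ i]ffunE.
    by case: ifP.
  by split; apply/hoch_leP => i; move: (H' i); rewrite leq_min => /andP[].
have le j : (u j <= min_word v w j)%N by rewrite min_wordE leq_min uv uw.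
rewrite /= [fix_word _ i]ffunE; case: ifP => // /andP[/eqP f1].
case/existsP => j /andP[ji /eqP fj0].
have uj : u j = 0 :> nat by have := le j; rewrite fj0 leqn0 => /eqP.
move: (le i) (triword_T3 ji uj); rewrite f1.
by case: (nat_of_ord (u i)) => [|[|k]].
Qed.

Fact hoch_leUx u v w : (hoch_join u v <= w) = (u <= w) && (v <= w).
Proof.
apply/hoch_leP/andP => [H|[/hoch_leP uw /hoch_leP vw] i].
  by split; apply/hoch_leP => i; move: (H i);
    rewrite max_wordE geq_max => /andP[].
by rewrite max_wordE geq_max uw vw.
Qed.

HB.instance Definition _ :=
  Order.POrder_MeetJoin_isLattice.Build hoch_display triword hoch_lexI hoch_leUx.

Fact zero_word_subproof : is_triword [ffun=> ord0].
Proof. by apply/triwordP; split=> [i|i j] *; rewrite ffunE. Qed.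

Definition zero_word : triword := Triword zero_word_subproof.

Fact zero_word_le u : zero_word <= u.
Proof. by apply/hoch_leP => i; rewrite ffunE. Qed.

HB.instance Definition _ :=
  Order.hasBottom.Build hoch_display triword zero_word_le.

Lemma hoch_joinE u v i : (u `|` v) i = maxn (u i) (v i) :> nat.
Proof. exact: max_wordE. Qed.

Lemma hoch_meet_min u v i : ((u `&` v) i <= minn (u i) (v i))%N.
Proof.
by rewrite -min_wordE [(u `&` v) i]ffunE; case: ifP.
Qed.

Lemma hoch_meetE u v (i : 'I_n) :
  (forall j : 'I_n, (j < i)%N -> (0 < u j)%N && (0 < v j)%N) ->
  (u `&` v) i = minn (u i) (v i) :> nat.
Proof.
move=> H; rewrite -min_wordE [(u `&` v) i]ffunE.
case: ifP => // /andP[_ /existsP[j /andP[/H]]].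
by rewrite -leq_min -min_wordE lt0n => /negPf ->.
Qed.

Lemma hoch_meet2 u v i : (1 < minn (u i) (v i))%N ->
  (u `&` v) i = minn (u i) (v i) :> nat.
Proof.
move=> H; rewrite -min_wordE [(u `&` v) i]ffunE.
by case: ifP => // /andP[/eqP]; rewrite min_wordE => E; rewrite E in H.
Qed.

Lemma triword_lt3 u i : (u i < 3)%N.
Proof. exact: ltn_ord. Qed.

Fact hoch_join_semidistributive u v w :
  u `|` v = u `|` w -> u `|` (v `&` w) = u `|` v.
Proof.
move=> E; have Ei i : maxn (u i) (v i) = maxn (u i) (w i).
  by rewrite -!hoch_joinE E.
apply: triword_inj => i; rewrite !hoch_joinE [(v `&` w) i]ffunE.
case: ifP => [/andP[/eqP m1 /existsP[j /andP[ji /eqP m0]]]|_]; last first.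
  by rewrite min_wordE maxn_minr -Ei minnn.
move: m0 m1 (Ei i) (triword_T3 (u := v) ji) (triword_T3 (u := w) ji).
rewrite !min_wordE /=.
move: (triword_lt3 u i) (triword_lt3 v i) (triword_lt3 w i).
move: (nat_of_ord (v j)) (nat_of_ord (w j)) => vj wj.
move: (nat_of_ord (u i)) (nat_of_ord (v i)) (nat_of_ord (w i)).
move=> a b c a3 b3 c3 /eqP; rewrite -leqn0 geq_min !leqn0 => zero m1 M H1 H2.
have {zero H1 H2}: (b != 1) || (c != 1).
  by case/orP: zero => /eqP zero; apply/orP; [left|right]; apply/eqP; auto.
by case: a b c a3 b3 c3 m1 M => [|[|[|?]]] [|[|[|?]]] [|[|[|?]]].
Qed.

Fact hoch_meet_semidistributive u v w :
  u `&` v = u `&` w -> u `&` (v `|` w) = u `&` v.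
Proof.
move=> E; apply/le_anti/andP; split; last first.
  by rewrite lexI leIl leIx2 ?leUl ?orbT.
set m := u `&` (v `|` w); apply/hoch_leP => i.
have mE j : (m j <= minn (u j) (maxn (v j) (w j)))%N.
  by rewrite -hoch_joinE; apply: hoch_meet_min.
have uvw j : (u `&` v) j = (u `&` w) j :> nat by rewrite E.
case m0: (nat_of_ord (m i)) => [|k] //; rewrite -m0.
have {k m0} mi : (0 < m i)%N by rewrite m0.
have [mi1|mi2] := leqP (m i) 1; last first.
  have := mE i; rewrite minn_maxr leq_max => /orP[] le.
    by rewrite hoch_meet2 // (leq_trans mi2 le).
  by rewrite uvw hoch_meet2 // (leq_trans mi2 le).
have mj (j : 'I_n) : (j < i)%N -> (0 < m j)%N.
  move=> ji; rewrite lt0n; apply/eqP => /(triword_T3 ji); apply.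
  by apply/eqP; rewrite eqn_leq mi1.
have pos : forall k (j : 'I_n), (j < k)%N -> (j < i)%N ->
    (0 < u j)%N && (0 < v j)%N && (0 < w j)%N.
  elim=> // k IH j jk ji.
  have H (l : 'I_n) : (l < j)%N -> (0 < u l)%N && (0 < v l)%N && (0 < w l)%N.
    by move=> lj; apply: IH (leq_trans lj jk) (ltn_trans lj ji).
  have := leq_trans (mj j ji) (mE j); rewrite leq_min leq_max => /andP[uj vwj].
  have Ev : (u `&` v) j = minn (u j) (v j) :> nat.
    by apply: hoch_meetE => l /H /andP[].
  have Ew : (u `&` w) j = minn (u j) (w j) :> nat.
    by apply: hoch_meetE => l /H /andP[/andP[-> _] ->].
  have := uvw j; rewrite {}Ev {}Ew.
  move: uj vwj; rewrite !lt0n.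
  by case: (nat_of_ord (u j)) (nat_of_ord (v j)) (nat_of_ord (w j))
    => [|?] [|?] [|?] //; rewrite minn0 ?minnSS.
have posi (j : 'I_n) (ji : (j < i)%N) := pos i j ji ji.
have mv : (u `&` v) i = minn (u i) (v i) :> nat.
  by apply: hoch_meetE => j /posi /andP[].
have mw : (u `&` w) i = minn (u i) (w i) :> nat.
  by apply: hoch_meetE => j /posi /andP[/andP[-> _] ->].
have := mE i; rewrite minn_maxr leq_max => /orP[] le; first by rewrite mv.
by rewrite uvw mw.
Qed.

HB.instance Definition _ := Lattice_isSemidistributive.Build hoch_display triword
  hoch_join_semidistributive hoch_meet_semidistributive.

End Triwords.

Local Open Scope ring_scope.

Section Triangles.
Variables (n : nat) (K : fieldType).

Definition M_triangle (x y : K) : K :=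
  \sum_(u : CLO (triword n)) \sum_(v : CLO (triword n))
    (mobius u v)%:~R * x ^+ rank u * y ^+ rank v.

Definition F_triangle (x y : K) : K :=
  y ^+ n * M_triangle ((y + 1) / (y - x)) ((y - x) / y).

End Triangles.

Section Statistic.
Variable n : nat.
Implicit Types (u : triword n) (A : {set triword n}).

Definition Atom : {set triword n} := [set a | covers \bot%O a].

Definition neg u : nat := #|Can u :&: Atom|.

(* For A \subset lower_covers u, neg_tilde u A is the number of lower covers of
   u outside A whose label is an atom (lower covers of u have distinct labels).
   Hence #|A| + neg_tilde u A <= #|lower_covers u| <= n, and neither
   this subtraction nor that in n - #|A| - neg_tilde u A truncates. *)
Definition neg_tilde u A : nat :=
  (neg u - #|[set u' in A | label u' u \in Atom]|)%N.

End Statistic.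

(* The field Q(x, y) of rational functions in two variables. *)
Definition ratfun2 : fieldType := {fraction {mpoly rat[2]}}.

Definition var_x : ratfun2 := tofrac ('X_(ord0 : 'I_2)).
Definition var_y : ratfun2 := tofrac ('X_(ord_max : 'I_2)).

(* Main.v *)
(* Write a triword as the pair (l, T) of the position l of its last 1 (if any) and
   the set T of positions of its 2s: the entries outside T are 1 up to l and 0
   after it. A cover relation lowers a single entry; lowering a 2 at i gives the
   atom with a 2 at i as label, lowering the last 1 at l gives the label
   (1,..,1,0,..,0) with last 1 at l. The nucleus of (l, T) is (1,..,1,0,..,0) with
   0 from l on, so the core label set records T together with the run R(l, T) of
   positions j >= l such that all of l+1, .., j are in T. Hence
   (l, T) is below (l', T') in the core label order iff T is contained in T' and l,
   if present, lies in R(l', T'); the rank of (l, T) is |T|, plus 1 if l is present.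

   The sum of mu(u, v) X^(rk u) over u is therefore (X - 1)^|T| (X - |R(l, T)|), the
   last factor being absent without l: by Moebius inversion it is enough that
   these weights, summed over the u below v = (l', T'), give X^(rk v), which holds
   because for T contained in T' the runs R(l, T) with l in R(l', T') but not in T
   partition R(l', T'). The same
   counting with (l', T') the greatest triword evaluates F_n, and both sides of
   the theorem become, with s = x + y + 1,
   s^n + (n - 1) x (x + 1) s^(n - 2). *)
Require Import Defs.
From mathcomp Require Import all_boot all_order all_algebra.
From mathcomp Require Import fraction mpoly.
From mathcomp Require Import ring zify.

Set Implicit Arguments.
Unset Strict Implicit.
Unset Printing Implicit Defensive.

Import Order.TTheory GRing.Theory Num.Theory.

Local Open Scope ring_scope.

(** * Möbius inversion and rank in a finite poset *)

Section Moebius.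
Context {d : Order.disp_t} {P : finPOrderType d}.
Implicit Types (x y z : P).

(** A recursive call at z only sees the interval [x, z), which lacks z and so is smaller than [x,
    y). Hence any fuel from the size of [x, y) on gives the same value. *)
Lemma mobius_rec_fuel k k' x y :
  (#|[set z | (x <= z < y)%O]| <= k)%N -> (#|[set z | (x <= z < y)%O]| <= k')%N ->
  mobius_rec k x y = mobius_rec k' x y.
Proof.
have base j w : (#|[set z | (x <= z < w)%O]| <= 0)%N -> 
    mobius_rec j x w = (if x == w then 1 else 0).
  rewrite leqn0 cards_eq0 => /eqP E.
  case: j => //= j; case: eqP => // _; case: ifP => // xw.
  by have := in_set0 x; rewrite -E inE lexx xw.
elim: k k' y => [|k IH] k' y hk hk'; first by rewrite !base.
case: k' hk' => [|k'] hk'; first by rewrite !base.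
rewrite /=; case: eqP => // _; case: ifP => // xy; congr (- _).
apply: eq_bigr => z /andP[xz zy].
have lt: (#|[set w | (x <= w < z)%O]| < #|[set w | (x <= w < y)%O]|)%N.
  apply: proper_card; apply/properP; split.
    by apply/subsetP => w; rewrite !inE => /andP[-> /lt_trans->].
  by exists z; rewrite !inE xz ?zy // ltxx.
by apply: IH; rewrite -ltnS (leq_trans lt).
Qed.

Lemma mobiusE x y : mobius x y =
  if x == y then 1
  else if (x < y)%O then - \sum_(z : P | (x <= z < y)%O) mobius x z else 0.
Proof.
(* One more unit of fuel lets the recursion unfold once while the inner calls keep the fuel of
   [mobius]. *)
rewrite /mobius (@mobius_rec_fuel _ #|P|.+1) ?max_card //=.
by rewrite (leq_trans (max_card _)).
Qed.

Lemma sum_mobius_right x y :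
  \sum_(z | (z <= y)%O) mobius x z = (x == y)%:R.
Proof.
transitivity (\sum_(z | (x <= z <= y)%O) mobius x z).
  rewrite big_mkcond [RHS]big_mkcond; apply: eq_bigr => z _.
  case: ifP => [zy|zy]; last by rewrite andbF.
  rewrite andbT; case: ifP => // xz; rewrite mobiusE; case: eqP => [E|_].
    by rewrite E lexx in xz.
  by rewrite lt_neqAle xz andbF.
have [xy|nxy] := boolP (x <= y)%O; last first.
  rewrite big1 => [|z /andP[xz zy]]; last by rewrite (le_trans xz zy) in nxy.
  by case: eqP nxy => // ->; rewrite lexx.
rewrite (bigD1 y) /= ?xy ?lexx // mobiusE.
rewrite (eq_bigl (fun z => x <= z < y)%O) => [|z]; last first.
  by rewrite lt_neqAle -andbA [(_ <= y)%O && _]andbC.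
case: eqP => [E|/eqP ne].
  rewrite big_pred0 ?addr0 // => z; rewrite E.
  by apply/negP => /andP[/le_lt_trans H /H]; rewrite ltxx.
by rewrite lt_neqAle ne xy addNr.
Qed.

(* A one-sided inverse of a square matrix is two-sided, which transposes the
   defining recursion of the Moebius function. *)
Lemma sum_mobius_left x y :
  \sum_(z | (x <= z)%O) mobius z y = (x == y)%:R.
Proof.
pose A := \matrix_(i < #|P|, j < #|P|) mobius (enum_val i) (enum_val j).
pose Z := \matrix_(i < #|P|, j < #|P|) ((enum_val i <= enum_val j)%O%:R : int).
have AZ : A *m Z = 1%:M.
  apply/matrixP => i j; rewrite !mxE -(inj_eq enum_val_inj) -sum_mobius_right.
  rewrite [RHS]big_mkcond (reindex (@enum_val _ P)) /=; last first.
    exact/onW_bij/enum_val_bij.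
  by apply: eq_bigr => k _; rewrite !mxE mulr_natr; case: ifP.
have /matrixP/(_ (enum_rank x) (enum_rank y)) := mulmx1C AZ.
rewrite !mxE (inj_eq enum_rank_inj) => <-.
rewrite [LHS]big_mkcond (reindex (@enum_val _ P)) /=; last first.
  exact/onW_bij/enum_val_bij.
by apply: eq_bigr => k _; rewrite !mxE !enum_rankK mulr_natl; case: ifP.
Qed.

(** Expanding f and exchanging the sums leaves, at each z, the sum of mu(x, y) over x >= z, which
    vanishes unless z = y. *)
Lemma mobius_inversion (R : pzRingType) (f g : P -> R) :
  (forall y, f y = \sum_(x | (x <= y)%O) g x) ->
  forall y, \sum_x (mobius x y)%:~R * f x = g y.
Proof.
move=> fE y.
transitivity (\sum_x \sum_z if (z <= x)%O then (mobius x y)%:~R * g z else 0).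
  by apply: eq_bigr => x _; rewrite fE mulr_sumr big_mkcond.
rewrite exchange_big /= (bigD1 y) //= [X in _ + X]big1 ?addr0 => [|z /negPf zy].
  by rewrite -big_mkcond -mulr_suml -rmorph_sum /= sum_mobius_left eqxx mul1r.
by rewrite -big_mkcond -mulr_suml -rmorph_sum /= sum_mobius_left zy mul0r.
Qed.

(** On a chain with top x the map s is injective with values at most s x, which bounds its size;
    descending from x by steps of one in s builds a chain that attains the bound. *)
Lemma rank_eq (s : P -> nat) :
  (forall x y, (x < y)%O -> (s x < s y)%N) ->
  (forall y, (0 < s y)%N -> exists2 x, (x < y)%O & s y = (s x).+1) ->
  rank =1 s.
Proof.
move=> mono pred x; apply/eqP; rewrite eqn_leq; apply/andP; split.
  apply/bigmax_leqP => C /and3P[/forall_inP ch xC /forall_inP top].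
  suff: (#|C| <= (s x).+1)%N by case: #|C|.
  rewrite -[(s x).+1]card_ord -(@card_in_imset _ _ (fun y => inord (s y) : 'I_(s x).+1)).
    exact: max_card.
  have sle y : y \in C -> (s y < (s x).+1)%N.
    by move/top; rewrite le_eqVlt => /orP[/eqP ->//|/mono/ltnW].
  move=> y z yC zC /(congr1 val); rewrite /= !inordK ?sle // => E.
  move/forall_inP: (ch _ yC) => /(_ _ zC); rewrite /Order.comparable.
  rewrite !le_eqVlt => /orP[/orP[/eqP//|]|/orP[/eqP//|]] /mono; by rewrite E ltnn.
have [C [ch xC top cC]] : exists C : {set P}, [/\ is_chain C, x \in C,
    [forall y in C, (y <= x)%O] & #|C| = (s x).+1].
  move E: (s x) => k; elim: k x E => [|k IH] x E.
    exists [set x]; split; rewrite ?set11 ?cards1 //.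
      apply/forall_inP => y /set1P ->; apply/forall_inP => z /set1P ->.
      exact: comparablexx.
    by apply/forall_inP => y /set1P ->.
  have [|y yx Ey] := pred x; first by rewrite E.
  have [|C [/forall_inP ch yC /forall_inP top cC]] := IH y.
    by move: Ey; rewrite E => -[].
  have topx z : z \in C -> (z < x)%O by move/top/le_lt_trans; apply.
  exists (x |: C); split; rewrite ?setU11 //.
  - apply/forall_inP => z zC; apply/forall_inP => w wC.
    case/setU1P: zC => [->|zC]; case/setU1P: wC => [->|wC].
    + exact: comparablexx.
    + by rewrite /Order.comparable (ltW (topx _ wC)) orbT.
    + by rewrite /Order.comparable (ltW (topx _ zC)).
    + by move/forall_inP: (ch _ zC) => /(_ _ wC).
  - by apply/forall_inP => z /setU1P[->//|/topx/ltW].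
  - rewrite cardsU1 cC; case: (boolP (x \in C)) => // /topx; by rewrite ltxx.
have -> : s x = #|C|.-1 by rewrite cC.
by apply: leq_bigmax_cond; apply/and3P.
Qed.

End Moebius.

(** * Sums over the subsets of a finite set *)

Section SubsetSums.
Variables (R : comPzRingType) (I : finType).

Lemma sum_subset_prod (D : {set I}) (f g : I -> R) :
  \sum_(A : {set I} | A \subset D) (\prod_(i in D) if i \in A then f i else g i) =
  \prod_(i in D) (f i + g i).
Proof.
rewrite [RHS]big_mkcond /=.
(* Outside D the factor 1 is written 0 + 1, so that distributing over all subsets of I kills every A
   not contained in D. *)
rewrite (eq_bigr (fun i => (if i \in D then f i else 0) + (if i \in D then g i else 1))); last first.
  by move=> i _; case: ifP => //; rewrite add0r.
rewrite bigA_distr big_mkcond; apply: eq_bigr => A _.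
case: ifP => [sAD|/negbT/subsetPn[i iA iD]].
  rewrite big_mkcond; apply: eq_bigr => i _.
  case: ifP => iD; case: ifP => // iA.
  by rewrite (subsetP sAD) in iD.
by rewrite (bigD1 i) //= iA (negPf iD) mul0r.
Qed.

Lemma sum_subset_expr (D : {set I}) (t : R) :
  \sum_(A : {set I} | A \subset D) t ^+ #|A| = (t + 1) ^+ #|D|.
Proof.
rewrite -[RHS]prodr_const -sum_subset_prod; apply: eq_bigr => A sAD.
rewrite -prodr_const -big_mkcondr /=; apply: eq_bigl => i.
by rewrite andb_idl // => /(subsetP sAD).
Qed.

Lemma sum_subset_avoid_expr (D : {set I}) (i : I) (t : R) :
  \sum_(A : {set I} | (A \subset D) && (i \notin A)) t ^+ #|A| =
  (t + 1) ^+ #|D :\ i|.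
Proof.
rewrite -sum_subset_expr; apply: eq_bigl => A.
by rewrite subsetD1.
Qed.

End SubsetSums.

(** * Triwords encoded by their last 1 and their set of 2s *)

Section Encoding.
Local Open Scope nat_scope.
Variable N : nat.
Local Notation n := N.+1.
Implicit Types (u v w a b c : triword n) (T : {set 'I_n}) (i j k l : 'I_n) (m : nat).

Definition twos u : {set 'I_n} := [set i | u i == 2 :> nat].

(** Positions are shifted by one so that 0 means that there is no 1. *)
Definition last_one u : nat := \max_(i | u i == 1 :> nat) i.+1.

Lemma last_one_gt u i : u i = 1 :> nat -> (i < last_one u)%N.
Proof. by move=> /eqP ui; rewrite /last_one (bigD1 i) //= leq_max leqnn. Qed.

Lemma last_oneP u : (0 < last_one u)%N ->
  exists2 l : 'I_n, last_one u = l.+1 & u l = 1 :> nat.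
Proof.
move=> m0; case: (pickP (fun i : 'I_n => u i == 1 :> nat)) => [i0 ui0|no].
  rewrite /last_one (bigop.bigmax_eq_arg i0) //.
  by case: arg_maxnP => // l /eqP ul _; exists l.
by move: m0; rewrite /last_one big_pred0.
Qed.

Lemma twos0 u : ord0 \notin twos u.
Proof. by rewrite inE; apply/eqP/triword_T2. Qed.

Lemma last_one_twos u i : i.+1 = last_one u -> i \notin twos u.
Proof.
move=> Ei; have [|l El ul] := @last_oneP u; first by rewrite -Ei.
suff -> : i = l by rewrite inE ul.
by apply: val_inj; move: El; rewrite -Ei => -[].
Qed.

(** By (T3) no 0 precedes the last 1, and no 1 follows it. *)
Lemma triwordE u i : u i = (if i \in twos u then 2 else (i < last_one u)%N) :> nat.
Proof.
rewrite inE; case: eqP => [//|u2].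
have u3 := ltn_ord (u i).
case: (ltnP i (last_one u)) => [lt|le].
  have [|l El ul] := @last_oneP u; first exact: leq_ltn_trans lt.
  rewrite El ltnS in lt.
  have : u i <> 0 :> nat.
    move: lt; rewrite leq_eqVlt => /orP[/eqP/val_inj -> |il ui]; first by rewrite ul.
    exact: (triword_T3 il ui).
  by rewrite /=; lia.
have : u i <> 1 :> nat by move/last_one_gt; rewrite ltnNge le.
by rewrite /=; lia.
Qed.

(** The test [0 < i] enforces (T2), so that every m and T yield a triword. *)
Definition word_of m T : {ffun 'I_n -> 'I_3} :=
  [ffun i : 'I_n => inord (if (i \in T) && (0 < i)%N then 2 else (i < m)%N)].

Lemma word_ofE m T i :
  word_of m T i = (if (i \in T) && (0 < i)%N then 2 else (i < m)%N) :> nat.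
Proof. by rewrite ffunE inordK //; case: ifP => //; case: (i < m). Qed.

Fact word_of_subproof m T : is_triword (word_of m T).
Proof.
apply/triwordP; split=> [i i0|i j ij].
  by rewrite word_ofE i0 ltnn andbF; case: ltnP.
rewrite !word_ofE; case: ifP => // _; case: ltnP => // im _.
case: ifP => // _; by rewrite ltnNge (leq_trans im (ltnW ij)).
Qed.

(* The triword with entry 2 exactly on T (minus the first position) and whose
   remaining entries are 1 before position m and 0 from m on. *)
Definition tw m T : triword n := Triword (word_of_subproof m T).

Lemma twE m T i : ord0 \notin T ->
  tw m T i = (if i \in T then 2 else (i < m)%N) :> nat.
Proof.
move=> T0; rewrite [LHS]word_ofE; case: (boolP (i \in T)) => //= iT.
rewrite lt0n; case: eqP => //= i0; case/negP: T0.
by rewrite -(_ : i = ord0) //; apply: val_inj.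
Qed.

Lemma tw_twos_last u : tw (last_one u) (twos u) = u.
Proof. by apply: triword_inj => i; rewrite twE ?twos0 // -triwordE. Qed.

Lemma twos_tw m T : ord0 \notin T -> twos (tw m T) = T.
Proof.
move=> T0; apply/setP => i; rewrite inE twE //; case: ifP => //.
by case: ltnP.
Qed.

Lemma last_one_tw0 T : ord0 \notin T -> last_one (tw 0 T) = 0.
Proof. by move=> T0; rewrite /last_one big_pred0 // => i; rewrite twE //; case: ifP. Qed.

Lemma last_one_twS l T : ord0 \notin T -> l \notin T -> last_one (tw l.+1 T) = l.+1.
Proof.
move=> T0 lT; apply/eqP; rewrite eqn_leq; apply/andP; split.
  apply/bigmax_leqP => i; rewrite twE //; case: ifP => // _; by case: ltnP.
by apply: last_one_gt; rewrite twE // (negPf lT) ltnSn.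
Qed.

(** Without a 1 the set T of 2s determines the word; otherwise the position l of the last 1 together
    with T does, and l lies outside T. By (T2) the first position is never in T. *)
Lemma sum_triwords (V : nmodType) (F : triword n -> V) :
  (\sum_u F u = \sum_(T : {set 'I_n} | T \subset [set~ ord0]) F (tw 0 T) +
    \sum_l \sum_(T : {set 'I_n} | (T \subset [set~ ord0]) && (l \notin T)) F (tw l.+1 T))%R.
Proof.
have D0 T : (T \subset [set~ ord0]) = (ord0 \notin T).
  by rewrite subsetC sub1set inE.
rewrite (bigID (fun u => last_one u == 0)) /=; congr (_ + _)%R.
  rewrite (reindex_onto (tw 0) twos) => [|u /eqP u0] /=; last first.
    by rewrite -[RHS]tw_twos_last u0.
  apply: eq_bigl => T; rewrite D0; apply/andP/idP => [[_ /eqP <-]|T0].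
    exact: twos0.
  by rewrite last_one_tw0 // twos_tw.
rewrite pair_big_dep /=.
rewrite (reindex_onto (fun p : 'I_n * {set 'I_n} => tw p.1.+1 p.2)
  (fun u => (inord (last_one u).-1, twos u))) => [|u u0] /=; last first.
  have [|l El _] := @last_oneP u; first by rewrite lt0n.
  by rewrite -[RHS]tw_twos_last El /= inord_val.
apply: eq_bigl => -[l T] /=; rewrite D0; apply/andP/andP => [[u0]|[T0 lT]].
  case/eqP => E ET; rewrite -ET twos0 last_one_twos //.
  have [|k Ek _] := @last_oneP (tw l.+1 T); first by rewrite lt0n.
  by rewrite Ek; rewrite Ek /= inord_val in E; rewrite E.
by rewrite last_one_twS // twos_tw //= inord_val eqxx.
Qed.

(** * Labels of cover relations *)

Definition atom2 i := tw 0 [set i].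
Definition chain1 i := tw i.+1 set0.

(** At the first position [atom2] degenerates to the zero word, whence the hypothesis. *)
Lemma atom2E i k : i != ord0 -> atom2 i k = (if k == i then 2 else 0) :> nat.
Proof. by move=> i0; rewrite twE inE ?ltn0 // eq_sym. Qed.

Lemma chain_wordE m k : tw m set0 k = (k < m)%N :> nat.
Proof. by rewrite twE inE. Qed.

Lemma atom2_inj i j : i != ord0 -> atom2 i = atom2 j -> i = j.
Proof.
move=> i0 E; have := atom2E i i0; rewrite eqxx E [RHS]/=.
rewrite /atom2 [nat_of_ord _ in LHS]word_ofE inE ltn0; case: ifP => // /andP[/eqP//].
Qed.

Lemma chain1_inj : injective chain1.
Proof.
move=> i j E; apply/val_inj/eqP; rewrite eqn_leq.
have Ei : (i < j.+1)%N = (i < i.+1)%N :> nat by rewrite -!chain_wordE -/(chain1 _) -E.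
have Ej : (j < j.+1)%N = (j < i.+1)%N :> nat by rewrite -!chain_wordE -/(chain1 _) -E.
by move: Ei Ej => /=; lia.
Qed.

Lemma atom2_neq_chain1 i j : i != ord0 -> atom2 i != chain1 j.
Proof.
move=> i0; apply/eqP => E; have := atom2E i i0.
by rewrite eqxx E chain_wordE; case: ltnP.
Qed.

Lemma atom2_le i u : i != ord0 -> (atom2 i <= u)%O = (i \in twos u).
Proof.
move=> i0; rewrite inE; apply/hoch_leP/eqP => [/(_ i)|ui k].
  by rewrite atom2E // eqxx; have := ltn_ord (u i); lia.
by rewrite atom2E //; case: eqP => // ->; rewrite ui.
Qed.

Lemma chain1_le i u : (chain1 i <= u)%O = [forall k : 'I_n, (k <= i)%N ==> (0 < u k)%N].
Proof.
apply/hoch_leP/forallP => H k.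
  by apply/implyP => ki; have := H k; rewrite chain_wordE ltnS ki.
by rewrite chain_wordE ltnS; case: (boolP (k <= i)) => // ki; exact: (implyP (H k)).
Qed.

Lemma chain1_le1 i u : u i = 1 :> nat -> (chain1 i <= u)%O.
Proof.
move=> ui; rewrite chain1_le; apply/forallP => k; apply/implyP.
rewrite leq_eqVlt => /orP[/eqP/val_inj -> |ki]; first by rewrite ui.
by rewrite lt0n; apply/eqP => /(triword_T3 ki); rewrite ui.
Qed.

Lemma label_eq a b c : is_label a b c -> label a b = c.
Proof.
move=> H; have /andP[/eqP ac /forallP min_c] := H.
have le_ab : (a <= b)%O by rewrite -ac leUl.
have /andP[/eqP al /forallP min_l] := is_labelP le_ab.
apply/le_anti/andP; split; first by apply: (implyP (min_l c)); rewrite ac.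
by apply: (implyP (min_c (label a b))); rewrite al.
Qed.

Lemma cover_join a b c : covers a b -> (c <= b)%O -> ~~ (c <= a)%O -> (a `|` c)%O = b.
Proof.
move=> /andP[ab /negP no] cb ca; apply/eqP; case: eqP => // ne; case: no.
apply/existsP; exists (a `|` c)%O; rewrite !lt_neqAle leUl leUx (ltW ab) cb !andbT.
by apply/andP; split; [rewrite eq_sym eq_joinl | apply/eqP].
Qed.

(** Joins are componentwise maxima, so any c whose join with a is b must supply the 2 at i itself
    and lies above [atom2 i]. *)
Lemma label_atom2 a b i : covers a b -> b i = 2 :> nat -> (a i < 2)%N ->
  label a b = atom2 i.
Proof.
move=> cab bi ai.
have i0 : i != ord0 by apply/eqP => E; move: bi; apply: triword_T2; rewrite E.
have J : (a `|` atom2 i)%O = b.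
  by apply: cover_join => //; rewrite atom2_le // inE ?bi // neq_ltn ai.
apply: label_eq; rewrite /is_label J eqxx /=.
apply/forallP => c; apply/implyP => /eqP E; rewrite atom2_le // inE.
by move: bi; rewrite -E hoch_joinE; move: ai; rewrite /maxn; case: ifP; lia.
Qed.

(** Any c whose join with a is b must supply the 1 at i, and (T3) makes c positive before i, hence c
    is above [chain1 i]. A 1 of b after i would come from a, against the 0 of a at i. *)
Lemma label_chain1 a b i : covers a b -> b i = 1 :> nat -> a i = 0 :> nat ->
  last_one b = i.+1 /\ label a b = chain1 i.
Proof.
move=> cab bi ai.
have J : (a `|` chain1 i)%O = b.
  apply: cover_join => //; first exact: chain1_le1.
  by apply/negP => /hoch_leP/(_ i); rewrite ai chain_wordE ltnSn.
split.
  apply/eqP; rewrite eqn_leq last_one_gt // andbT.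
  apply/bigmax_leqP => j /eqP bj; rewrite ltnS leqNgt; apply/negP => ij.
  apply: (triword_T3 ij ai); move: bj; rewrite -J hoch_joinE chain_wordE ltnS.
  by rewrite leqNgt ij maxn0.
apply: label_eq; rewrite /is_label J eqxx /=.
apply/forallP => c; apply/implyP => /eqP E; apply: chain1_le1.
by move: bi; rewrite -E hoch_joinE ai max0n.
Qed.

(** Indexed by the label, so that a case analysis on [coverP] also replaces [label a b]. *)
Variant cover_spec a b : triword n -> Prop :=
  | Cover2 i of i \in twos b & a i < 2 : cover_spec a b (atom2 i)
  | Cover1 i of last_one b = i.+1 & b i = 1 :> nat & a i = 0 :> nat :
      cover_spec a b (chain1 i).

Lemma coverP a b : covers a b -> cover_spec a b (label a b).
Proof.
move=> cab; have /andP[ab _] := cab.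
have [i2 | no2] := boolP [exists i : 'I_n, (b i == 2 :> nat) && (a i < 2)%N].
  have /existsP[i /andP[bi ai]] := i2.
  rewrite (label_atom2 cab _ ai); last exact/eqP.
  by apply: Cover2; rewrite ?inE.
have [i lt_i] : exists i : 'I_n, (a i < b i)%N.
  apply/existsP; apply: contraLR ab; rewrite negb_exists => /forallP H.
  rewrite lt_leAnge negb_and negbK; apply/orP; right.
  by apply/hoch_leP => i; rewrite leqNgt.
(* When no 2 is lowered, an entry that drops can only go from 1 to 0. *)
move: no2; rewrite negb_exists => /forallP/(_ i); rewrite negb_and -leqNgt => no2.
have b3 := ltn_ord (b i).
have bi : b i = 1 :> nat by move: no2; lia.
have ai : a i = 0 :> nat by lia.
by have [mb ->] := label_chain1 cab bi ai; apply: Cover1.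
Qed.

(** A lower cover of u above w agrees with u outside i, so it must drop at i. This produces lower
    covers that lower a chosen entry. *)
Lemma cover_below_at w u i : (w i < u i)%N ->
  (forall j, j != i -> w j = u j :> nat) ->
  exists2 c, covers c u & (w <= c)%O && (c i < u i)%N.
Proof.
move=> wi wj.
have wu : (w < u)%O.
  rewrite lt_leAnge; apply/andP; split.
    by apply/hoch_leP => j; case: (eqVneq j i) => [->|/wj->//]; apply: ltnW.
  by apply/negP => /hoch_leP/(_ i); rewrite leqNgt wi.
have [c cu wc] := exists_lower_cover wu; exists c => //; rewrite wc ltnNge.
apply/negP => ci; have /andP[] := cu; rewrite lt_leAnge => /andP[_ /negP uc _]; apply: uc.
apply/hoch_leP => j; case: (eqVneq j i) => [->//|/wj <-]; exact: (hoch_leP _ _ wc).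
Qed.

(** * Nuclei and core label sets *)

Lemma nucleus_le c u : covers c u -> (nucleus u <= c)%O.
Proof. by move=> cu; rewrite /nucleus leIx2 // (bigD1 c) ?inE //= leIl orbT. Qed.

Lemma nucleus_le_top u : (nucleus u <= u)%O.
Proof. by rewrite /nucleus leIl. Qed.

Lemma lower_cover2 u i : i \in twos u ->
  exists2 c, covers c u & (c i < 2)%N.
Proof.
move=> iT; have ui : u i = 2 :> nat by apply/eqP; rewrite inE in iT.
have T0 : ord0 \notin twos u :\ i by rewrite inE negb_and twos0 orbT.
have [|j ji|c cu /andP[_ ci]] := @cover_below_at (tw (last_one u) (twos u :\ i)) u i.
- by rewrite twE // !inE eqxx ui; case: (_ < last_one u).
- by rewrite twE // triwordE !inE ji.
- by exists c => //; rewrite ui in ci.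
Qed.

Lemma lower_cover1 u i : last_one u = i.+1 ->
  exists2 c, covers c u & c i = 0 :> nat.
Proof.
move=> Ei; have iT : i \notin twos u by apply: last_one_twos.
have ui : u i = 1 :> nat by rewrite triwordE (negPf iT) Ei ltnSn.
(* Moving the boundary back by one lowers only the 1 at i. *)
have [|j ji|c cu /andP[_ ci]] := @cover_below_at (tw i (twos u)) u i.
- by rewrite twE ?twos0 // (negPf iT) ltnn ui.
- rewrite twE ?twos0 // triwordE Ei ltnS; case: ifP => // _.
  by have : j <> i :> nat by [move/val_inj/eqP; rewrite (negPf ji)]; lia.
- by exists c => //; move: ci; rewrite ui; lia.
Qed.

(** Some lower cover lowers each given 2 and some lowers the last 1, so the nucleus has no 2 and is
    0 at l, hence by (T3) also after l. Conversely, if [tw l set0] were not below a lower cover,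
    their join would be u; but it can supply neither a 2 nor the 1 at l. *)
Lemma nucleusE u l : last_one u = l.+1 -> nucleus u = tw l set0.
Proof.
move=> El; apply/le_anti/andP; split.
  have nl : nucleus u l = 0 :> nat.
    have [c /nucleus_le/hoch_leP/(_ l) + cl] := lower_cover1 El.
    by rewrite cl; lia.
  apply/hoch_leP => k; rewrite chain_wordE.
  have nu := hoch_leP _ _ (nucleus_le_top u) k.
  have k2 : (nucleus u k < 2)%N.
    case: (boolP (k \in twos u)) => [/lower_cover2[c /nucleus_le/hoch_leP/(_ k) + ck]|kT].
      by lia.
    by move: nu; rewrite (triwordE u) (negPf kT); case: ltnP; lia.
  case: (ltngtP k l) => [kl|lk|/val_inj->]; last by rewrite nl.
    by lia.
  by have := triword_T3 lk nl; lia.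
have lu : (tw l set0 <= u)%O.
  apply/hoch_leP => k; rewrite chain_wordE (triwordE u) El ltnS.
  by case: ifP => _; case: ltnP => // /ltnW->.
rewrite /nucleus lexI lu; apply: (big_ind (fun c => (tw l set0 <= c)%O)) => //.
  by move=> a b la lb; rewrite lexI la.
move=> c; rewrite inE => cu; apply: contraT => /(cover_join cu lu) J.
case: (coverP cu) => i; first by rewrite inE -J hoch_joinE chain_wordE; lia.
rewrite El => -[Ei]; rewrite -J hoch_joinE chain_wordE Ei ltnn; lia.
Qed.

(* The run R(l, T) of the header is [run l.+1 T]: like [last_one], m is the
   successor of a position, so that 0 can stand for the absence of a 1. *)
Definition run m T : {set 'I_n} :=
  [set j : 'I_n | (m <= j.+1)%N & [forall k : 'I_n, (m <= k <= j)%N ==> (k \in T)]].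

(** These j turn out to index the core labels of the form [chain1 j]. *)
Definition chains u : {set 'I_n} :=
  if last_one u == 0 then set0 else run (last_one u) (twos u).

Lemma chain_cover l : covers (tw l set0) (chain1 l).
Proof.
have lt : (tw l set0 <= chain1 l)%O.
  by apply/hoch_leP => k; rewrite !chain_wordE; lia.
apply/andP; split.
  rewrite lt_leAnge lt; apply/negP => /hoch_leP/(_ l).
  by rewrite !chain_wordE ltnSn ltnn.
apply/negP => /existsP[z /andP[lz zc]].
have leL := hoch_leP _ _ (ltW lz); have leR := hoch_leP _ _ (ltW zc).
have neq k : k != l -> k <> l :> nat by move=> /eqP + /val_inj.
have [zl|zl] := posnP (z l).
  move: lz; rewrite lt_leAnge => /andP[_ /negP[]]; apply/hoch_leP => k.
  have [->|/neq kl] := eqVneq k l; first by rewrite zl.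
  by have := leR k; rewrite !chain_wordE; lia.
move: zc; rewrite lt_leAnge => /andP[_ /negP[]]; apply/hoch_leP => k.
have [->|/neq kl] := eqVneq k l; first by rewrite chain_wordE ltnSn.
by have := leL k; rewrite !chain_wordE; lia.
Qed.

(** For a cover of b over a with label [chain1 i] inside the core, b <= u makes u positive up to i,
    and a being 0 at i and above the nucleus forces i >= l; so i lies in the run. Conversely,
    [chain_cover] realizes the label inside the core, and each 2 is lowered directly below u. *)
Lemma core_labelsE u :
  core_labels u = [set atom2 i | i in twos u] :|: [set chain1 j | j in chains u].
Proof.
apply/setP => c; apply/imsetP/setUP => [[[a b] /=]|[]/imsetP[i]].
- rewrite inE /= => /and3P[na cab /hoch_leP bu] ->.
  case: (coverP cab) => i => [|mb bi ai].
    rewrite inE => /eqP bi ai; left; apply: imset_f; rewrite inE.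
    by have := bu i; have := ltn_ord (u i); lia.
  right; apply: imset_f.
  have pos k : k <= i -> 0 < u k.
    move=> ki; apply: leq_trans (bu k).
    by have /forallP/(_ k)/implyP := etrans (esym (chain1_le i b)) (chain1_le1 bi); apply.
  (* Without a 1 the first entry of u is 0, so no label [chain1 i] fits below u. *)
  rewrite /chains; case: eqP => [u0|/eqP].
    by have := pos ord0 isT; rewrite triwordE u0 (negPf (twos0 u)).
  rewrite -lt0n => /last_oneP[l El _]; rewrite El inE; apply/andP; split.
    rewrite leqNgt ltnS; apply/negP => il.
    by have := hoch_leP _ _ na i; rewrite (nucleusE El) chain_wordE ai il.
  apply/forallP => k; apply/implyP => /andP[lk /pos].
  by rewrite triwordE El; case: ifP; lia.
- move=> iT ->; have ui : u i = 2 :> nat by apply/eqP; rewrite inE in iT.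
  have [a cau ai] := lower_cover2 iT.
  exists (a, u) => /=; last by rewrite (label_atom2 cau ui).
  by rewrite inE /= nucleus_le // cau lexx.
- rewrite /chains; case: eqP => [u0|/eqP]; first by rewrite inE.
  rewrite -lt0n => /last_oneP[l El _]; rewrite El inE => /andP[li /forallP run_i] ->.
  have cc := chain_cover i.
  exists (tw i set0, chain1 i) => /=; last first.
    have c1 : chain1 i i = 1 :> nat by rewrite chain_wordE ltnSn.
    by rewrite (label_chain1 cc c1 _).2 // chain_wordE ltnn.
  rewrite inE /= cc (nucleusE El) chain1_le; apply/andP; split.
    by apply/hoch_leP => k; rewrite !chain_wordE; lia.
  apply/forallP => k; apply/implyP => ki; rewrite triwordE El.
  case: ifP => // /negbT kT; have := run_i k; rewrite ki (negPf kT) andbT.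
  by rewrite implybF -ltnNge => ->.
Qed.

(** * The core label order and its rank function *)

Lemma clo_leE u v : (u <= v :> CLO (triword n))%O =
  (twos u \subset twos v) && (chains u \subset chains v).
Proof.
have n0 w i : i \in twos w -> i != ord0 by apply: contraTneq => ->; apply: twos0.
rewrite [LHS]/Order.le /= /clo_le !core_labelsE.
apply/subUsetP/andP => [[/subsetP H1 /subsetP H2]|[/subsetP H1 /subsetP H2]].
  split; apply/subsetP => i iu.
    case/setUP: (H1 _ (imset_f atom2 iu)) => /imsetP[j jv E].
      by rewrite (atom2_inj (n0 _ _ iu) E).
    by have := atom2_neq_chain1 j (n0 _ _ iu); rewrite E eqxx.
  case/setUP: (H2 _ (imset_f chain1 iu)) => /imsetP[j jv E].
    by have := atom2_neq_chain1 i (n0 _ _ jv); rewrite E eqxx.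
  by rewrite (chain1_inj E).
split; apply/subsetP => _ /imsetP[i iu ->]; apply/setUP.
  by left; apply/imset_f/H1.
by right; apply/imset_f/H2.
Qed.

Lemma chains_tw0 T : ord0 \notin T -> chains (tw 0 T) = set0.
Proof. by move=> T0; rewrite /chains last_one_tw0. Qed.

Lemma chains_twS l T : ord0 \notin T -> l \notin T -> chains (tw l.+1 T) = run l.+1 T.
Proof. by move=> T0 lT; rewrite /chains last_one_twS // twos_tw. Qed.

Lemma run_start l T : l \in run l.+1 T.
Proof.
rewrite inE leqnn; apply/forallP => k; apply/implyP => /andP[lk kl].
by have := leq_trans lk kl; rewrite ltnn.
Qed.

Lemma clo_le_tw0 T v : ord0 \notin T ->
  (tw 0 T <= v :> CLO (triword n))%O = (T \subset twos v).
Proof. by move=> T0; rewrite clo_leE twos_tw // chains_tw0 // sub0set andbT. Qed.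

(** Positions up to l are covered by the run through l, later ones by the run of T. *)
Lemma run_sub m l T T' : T \subset T' -> l \in run m T' -> run l.+1 T \subset run m T'.
Proof.
move=> /subsetP TT'; rewrite inE => /andP[ml /forallP runl].
apply/subsetP => j; rewrite !inE => /andP[lj /forallP runj].
rewrite (leq_trans ml lj); apply/forallP => k; apply/implyP => /andP[mk kj].
have [kl|lk] := leqP k l; first by apply: (implyP (runl k)); rewrite mk.
by apply/TT'/(implyP (runj k)); rewrite lk.
Qed.

(** A run contains its start l, and [run_sub] shows that the start carries the whole run with it. *)
Lemma clo_le_twS l T v : ord0 \notin T -> l \notin T ->
  (tw l.+1 T <= v :> CLO (triword n))%O = (T \subset twos v) && (l \in chains v).
Proof.
move=> T0 lT; rewrite clo_leE twos_tw // chains_twS //.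
case: (boolP (T \subset _)) => //= TT'; apply/idP/idP => [/subsetP->//|].
  exact: run_start.
rewrite /chains; case: ifP => [_|_]; first by rewrite inE.
exact: run_sub.
Qed.

(** The size of the canonical join representation; [card_lower_covers] gives the count on lower
    covers. *)
Definition size_can u := #|twos u| + (0 < last_one u).

(** A step down by one drops the 1 if there is one, and otherwise a 2. Strictness is only at issue
    for equal sets of 2s; there, two comparable words that both have a 1 coincide. *)
Lemma clo_rank u : rank (u : CLO (triword n)) = size_can u.
Proof.
move: u; apply: (@rank_eq _ (CLO (triword n)) size_can) => [u v|v].
  rewrite lt_neqAle => /andP[/eqP ne uv].
  have : twos u \subset twos v by move: uv; rewrite clo_leE => /andP[].
  rewrite subEproper => /orP[/eqP ET|/proper_card lt]; last first.
    have : (0 < last_one u) -> (0 < last_one v).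
      move=> /last_oneP[l El _]; move: uv; rewrite -[u]tw_twos_last El.
      rewrite clo_le_twS ?twos0 ?last_one_twos // => /andP[_].
      by rewrite /chains lt0n; case: ifP => //; rewrite inE.
    by rewrite /size_can; lia.
  rewrite /size_can ET ltn_add2l.
  have [u0|/last_oneP[l El _]] := posnP (last_one u).
    rewrite lt0n; case: eqP => // v0; case: ne.
    by rewrite -[u]tw_twos_last -[v]tw_twos_last u0 v0 ET.
  move: uv; rewrite -[u in (u <= v)%O]tw_twos_last El.
  rewrite clo_le_twS ?twos0 ?last_one_twos // => /andP[_].
  rewrite /chains; case: eqP => [v0|/eqP]; first by rewrite inE.
  rewrite -lt0n => /last_oneP[l' El' _]; rewrite El' inE => /andP[l'l /forallP/(_ l)].
  (* As l is not the position of a 2, it can lie in the run of v only as its start. *)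
  rewrite leqnn andbT -ET (negPf (last_one_twos (esym El))) implybF -leqNgt => ll'.
  case: ne; rewrite -[u]tw_twos_last -[v]tw_twos_last El El' ET.
  by congr tw; apply/eqP; rewrite eqn_leq ltnS ll'.
have T0 := twos0 v.
have [v0|v0] := posnP (last_one v); last first.
  move=> _; exists (tw 0 (twos v)).
    rewrite lt_neqAle clo_le_tw0 // subxx andbT; apply/eqP => E.
    by move: v0; rewrite -E last_one_tw0.
  by rewrite /size_can v0 twos_tw // last_one_tw0 // addn0 addn1.
rewrite {1}/size_can v0 addn0 => /card_gt0P[i iT].
have T0i : ord0 \notin twos v :\ i by rewrite inE negb_and T0 orbT.
exists (tw 0 (twos v :\ i)).
  rewrite lt_neqAle clo_le_tw0 // subD1set andbT; apply/eqP => E.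
  by move: iT; rewrite -E twos_tw // !inE eqxx.
by rewrite /size_can v0 twos_tw // last_one_tw0 // (cardsD1 i (twos v)) iT !addn0.
Qed.
End Encoding.

(** * Canonical join representations, atoms and the statistic [neg] *)

Section CanonicalJoins.
Local Open Scope nat_scope.
Variable N : nat.
Local Notation n := N.+1.
Implicit Types (u v w a b c : triword n) (T : {set 'I_n}) (i j k l : 'I_n) (m : nat).

(** Two distinct lower covers join to u, but with equal labels both are lower than u at the same
    entry, and so is their join. *)
Lemma label_inj u : {in lower_covers u &, injective (label^~ u)}.
Proof.
move=> c c'; rewrite !inE => cu c'u.
have n0 i : i \in twos u -> i != ord0 by apply: contraTneq => ->; apply: twos0.
have join_ne : c != c' -> (c `|` c')%O = u.
  move=> ne; have /andP[lt' /negP no] := c'u; apply: cover_join => //.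
    exact: ltW.
  apply/negP => c'c; apply: no; apply/existsP; exists c.
  by rewrite lt_neqAle eq_sym ne c'c; case/andP: cu.
case: (coverP cu) => i; [move=> iT ci|move=> mi ui ci];
  case: (coverP c'u) => j; [move=> jT c'j|move=> mj uj c'j|move=> jT c'j|move=> mj uj c'j] => E.
- have {E} E : i = j by apply: atom2_inj E; apply: n0 iT.
  apply/eqP/contraT => /join_ne J; move: iT c'j ci.
  by rewrite inE -J hoch_joinE E; lia.
- by case/eqP: (atom2_neq_chain1 j (n0 _ iT)).
- by case/eqP: (atom2_neq_chain1 i (n0 _ jT)).
- apply/eqP/contraT => /join_ne J; move: ui.
  by rewrite -J hoch_joinE ci (chain1_inj E) c'j.
Qed.

Lemma CanE u : Can u = [set atom2 i | i in twos u] :|: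
  [set chain1 l | l in [set l : 'I_n | last_one u == l.+1]].
Proof.
apply/setP => c; apply/imsetP/setUP => [[a]|[]/imsetP[i]].
- rewrite inE => cau ->; case: (coverP cau) => i; first by left; apply: imset_f.
  by move=> mi _ _; right; apply: imset_f; rewrite inE mi.
- move=> iT ->; have [a cau ai] := lower_cover2 iT.
  exists a; rewrite ?inE // (label_atom2 cau _ ai) //.
  by apply/eqP; rewrite inE in iT.
- rewrite inE => /eqP mi ->; have [a cau ai] := lower_cover1 mi.
  exists a; rewrite ?inE //.
  have ui : u i = 1 :> nat.
    by rewrite triwordE (negPf (last_one_twos (esym mi))) mi ltnSn.
  by rewrite (label_chain1 cau ui ai).2.
Qed.

Lemma bottom_tw : \bot%O = tw 0 set0 :> triword n.
Proof. by apply: triword_inj => k; rewrite chain_wordE ffunE. Qed.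

(** A word strictly between could only have a 1 at i, which (T3) forbids after the 0 at the first
    position. *)
Lemma atom2_Atom i : i != ord0 -> atom2 i \in Atom n.
Proof.
move=> i0; rewrite inE bottom_tw; apply/andP; split.
  rewrite lt_neqAle -{2}bottom_tw le0x andbT; apply/eqP => /(congr1 (fun u => u i : nat)).
  by rewrite atom2E // eqxx chain_wordE.
apply/negP => /existsP[z /andP[lz zi]].
have := hoch_leP _ _ (ltW zi) => zle.
have z0 k : k != i -> z k = 0 :> nat.
  by move=> ki; have := zle k; rewrite atom2E // (negPf ki) leqn0 => /eqP.
have zi1 : z i <> 1 :> nat.
  by apply: (@triword_T3 _ z ord0 i); rewrite ?z0 1?eq_sym // lt0n; move/eqP: i0 => /eqP.
have zi2 := ltn_ord (z i).
have [zi0|zi0] := posnP (z i).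
  move: lz; rewrite lt_leAnge => /andP[_ /negP[]]; apply/hoch_leP => k.
  by have [->|/z0->] := eqVneq k i; rewrite ?zi0.
move: zi; rewrite lt_leAnge => /andP[_ /negP[]]; apply/hoch_leP => k.
rewrite atom2E //; case: eqP => // ->; lia.
Qed.

(** For later l, [chain1 ord0] lies strictly between the bottom and [chain1 l]. *)
Lemma chain1_Atom l : (chain1 l \in Atom n) = (l == ord0).
Proof.
rewrite inE bottom_tw; have [->|l0] := eqVneq l ord0; first exact: chain_cover.
apply/negP => /andP[_ /negP[]]; apply/existsP; exists (chain1 ord0).
have /andP[-> _] := @chain_cover N ord0.
rewrite /= lt_leAnge; apply/andP; split.
  by apply/hoch_leP => k; rewrite !chain_wordE /=; lia.
apply/negP => /hoch_leP/(_ l); rewrite !chain_wordE ltnSn ltnS leqn0.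
by case: eqP => // l00; case/eqP: l0; apply: val_inj.
Qed.

Lemma card_atom2_chain1 u (L : {set 'I_n}) :
  #|[set atom2 i | i in twos u] :|: [set chain1 l | l in L]| = #|twos u| + #|L|.
Proof.
have n0 i : i \in twos u -> i != ord0 by apply: contraTneq => ->; apply: twos0.
rewrite cardsU disjoint_setI0 ?cards0 ?subn0; last first.
  rewrite disjoint_sym; apply/pred0P => c /=; apply/negP => /andP[/imsetP[j _ ->]].
  by move=> /imsetP[i /n0 i0 E]; have := atom2_neq_chain1 j i0; rewrite E eqxx.
rewrite (card_imset _ (@chain1_inj N)); congr (_ + _).
by apply: card_in_imset => i j /n0 i0 _; apply: atom2_inj.
Qed.

Lemma card_last_one u : #|[set l : 'I_n | last_one u == l.+1]| = (0 < last_one u).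
Proof.
have [u0|/last_oneP[l -> _]] := posnP (last_one u).
  by apply: eq_card0 => l; rewrite inE u0.
by transitivity #|[set l]|; [apply: eq_card => k; rewrite !inE eqSS eq_sym|rewrite cards1].
Qed.

Lemma card_lower_covers u : #|lower_covers u| = size_can u.
Proof.
by rewrite -(card_in_imset (@label_inj u)) -/(Can u) CanE card_atom2_chain1 card_last_one.
Qed.

Lemma negE u : neg u = #|twos u| + (last_one u == 1).
Proof.
pose L := [set l : 'I_n | last_one u == l.+1] :&: [set ord0].
have -> : (last_one u == 1) = #|L| :> nat.
  case: eqP => [u1|u1].
    rewrite (_ : L = [set ord0]) ?cards1 //; apply/setIidPr.
    by rewrite sub1set inE u1.
  by apply/esym/eq_card0 => l; rewrite !inE; case: eqP => // E; case: eqP => // l0; case: u1; rewrite E l0.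
rewrite -card_atom2_chain1 /neg CanE setIUl; congr #|pred_of_set (_ :|: _)|.
  apply/setIidPl/subsetP => _ /imsetP[i iT ->]; apply: atom2_Atom.
  by apply: contraTneq iT => ->; apply: twos0.
apply/setP => c; apply/setIP/imsetP => [[/imsetP[l lL ->]]|[l]].
  by rewrite chain1_Atom => l0; exists l => //; rewrite inE lL inE.
by case/setIP => lL /set1P l0 ->; split; [apply: imset_f | rewrite chain1_Atom l0].
Qed.

Lemma neg_lower_covers u :
  neg u = #|[set c in lower_covers u | label c u \in Atom n]|.
Proof.
rewrite -(card_in_imset (f := label^~ u)); last first.
  by move=> c c'; rewrite !inE => /andP[cu _] /andP[c'u _]; apply: label_inj; rewrite inE.
congr #|pred_of_set _|; apply/setP => c; rewrite inE; apply/andP/imsetP.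
  by case=> /imsetP[a au ->] la; exists a => //; rewrite inE au.
by case=> a; rewrite inE => /andP[au la] ->; split=> //; apply: imset_f.
Qed.

Lemma size_can_le u : size_can u <= n.
Proof.
have : #|twos u| <= N.
  have cD : #|[set~ ord0 : 'I_n]| = N by rewrite cardsC1 card_ord.
  rewrite -[leqRHS]cD; apply: subset_leq_card.
  by rewrite subsetC sub1set inE twos0.
by rewrite /size_can; case: (0 < _); lia.
Qed.

(** Each i in the run of T' lies in exactly one smaller run, the one that starts at the last
    position l <= i outside T; such a position exists because l0 qualifies. *)
Lemma sum_run_cards l0 T T' : T \subset T' -> l0 \notin T' ->
  \sum_(l in run l0.+1 T' | l \notin T) #|run l.+1 T| = #|run l0.+1 T'|.
Proof.
move=> TT' l0T'.
transitivity (\sum_(l in run l0.+1 T' | l \notin T) \sum_i (i \in run l.+1 T)).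
  by apply: eq_bigr => l _; rewrite -sum1_card big_mkcond.
rewrite exchange_big -sum1_card [RHS]big_mkcond; apply: eq_bigr => i _ /=.
case: ifP => [ir|/negbT ir]; last first.
  apply: big1 => l /andP[lr _]; case: (boolP (i \in _)) => // il.
  by rewrite (subsetP (run_sub TT' lr) _ il) in ir.
have := ir; rewrite inE ltnS => /andP[l0i /forallP run_i].
have [l /andP[li lT] lmax] :
    exists2 l : 'I_n, (l <= i) && (l \notin T) & forall k : 'I_n, k <= i -> k \notin T -> k <= l.
  have h0 : (l0 <= i) && (l0 \notin T) by rewrite l0i (contra (subsetP TT' l0)).
  exists [arg max_(l > l0 | (l <= i) && (l \notin T)) l]; case: arg_maxnP => // l _ H.
  by move=> k ki kT; apply: H; rewrite ki.
have lr : l \in run l0.+1 T'.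
  rewrite inE ltnS lmax ?(contra (subsetP TT' l0)) //; apply/forallP => k.
  by apply/implyP => /andP[lk kl]; apply: (implyP (run_i k)); rewrite lk (leq_trans kl).
rewrite (bigD1 l) ?lr //= big1 => [|k /andP[/andP[kr kT] kl]].
  suff -> : i \in run l.+1 T by [].
  rewrite inE ltnS li; apply/forallP => k; apply/implyP => /andP[lk ki].
  by apply: contraLR lk => /(lmax _ ki); rewrite -leqNgt.
case: (boolP (_ \in _)) => //; rewrite inE ltnS => /andP[ki /forallP/(_ l)].
rewrite li (negPf lT) andbT implybF -leqNgt => lk.
case/eqP: kl; apply/val_inj/eqP; rewrite eqn_leq lk andbT; exact: lmax.
Qed.

End CanonicalJoins.

(** * The weighted sum over the partial cores of one element *)

Section PartialCores.
Variables (R : comPzRingType) (I : finType).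

Lemma prod_two_values (E at_ : {set I}) (x y : R) :
  \prod_(i in E) (if i \in at_ then y else x) =
  y ^+ #|E :&: at_| * x ^+ #|E :\: at_|.
Proof.
rewrite (bigID (mem at_)) /= -!prodr_const; congr (_ * _); apply: eq_big => i;
  rewrite ?inE //; first by case/andP => _ ->.
  by rewrite andbC.
by case/andP => _ /negPf->.
Qed.

(** This expands the product over C of 1 + y on [at_] and 1 + x off it: A collects the factors 1,
    and the rest of C the weights. The bound on C keeps the subtractions exact. *)
Lemma sum_subset_two_weights n (C at_ : {set I}) (x y : R) : (#|C| <= n)%N ->
  \sum_(A : {set I} | A \subset C)
    x ^+ (n - #|A| - (#|C :&: at_| - #|A :&: at_|)) *
    y ^+ (#|C :&: at_| - #|A :&: at_|) =
  x ^+ (n - #|C|) * ((1 + y) ^+ #|C :&: at_| * (1 + x) ^+ #|C :\: at_|).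
Proof.
move=> Cn; rewrite -prod_two_values.
rewrite (eq_bigr (fun i => 1 + if i \in at_ then y else x)); last first.
  by move=> i _; case: ifP.
rewrite -sum_subset_prod mulr_sumr; apply: eq_bigr => A AC.
rewrite (eq_bigr (fun i => if i \notin A then if i \in at_ then y else x else 1)); last first.
  by move=> i _; rewrite if_neg.
rewrite -big_mkcondr (eq_bigl (mem (C :\: A))) => [|i]; last by rewrite !inE andbC.
rewrite prod_two_values mulrCA mulrC -exprD.
have cC := cardsID at_ C; have cA := cardsID at_ A; have cCA := cardsID A C.
have cCA' := cardsID at_ (C :\: A).
have A_C : #|C :&: A| = #|A| by rewrite (setIidPr AC).
have E : #|(C :\: A) :&: at_| = (#|C :&: at_| - #|A :&: at_|)%N.
  rewrite setIDAC cardsD; congr (_ - #|pred_of_set _|)%N.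
  by rewrite setIAC (setIidPr AC).
have le : (#|A :&: at_| <= #|C :&: at_|)%N by apply/subset_leq_card/setSI.
rewrite E; congr (_ ^+ _ * _); congr (_ ^+ _); lia.
Qed.

End PartialCores.

(** * Closed forms of both sides *)

Section GeneratingFunctions.
Variables (N : nat).
Local Notation n := N.+1.
Implicit Types (u v : triword n) (T : {set 'I_n}) (l : 'I_n).

(** In the e part, l0 avoids T' and leaves all its subsets, while every other l of the run lies in
    T' and costs one exponent. In the f part, summing over l first gives [sum_run_cards]. For empty
    T' the run is just l0, so the truncated predecessor has multiplicity 0. *)
Lemma sum_subset_runs (R : comPzRingType) (T' : {set 'I_n}) (l0 : 'I_n) (z e f : R) :
  l0 \notin T' ->
  \sum_(l in run l0.+1 T') \sum_(T : {set 'I_n} | (T \subset T') && (l \notin T))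
    z ^+ #|T| * (e - f * #|run l.+1 T|%:R) =
  e * ((z + 1) ^+ #|T'| + (z + 1) ^+ #|T'|.-1 *+ #|run l0.+1 T' :\ l0|)
  - f * (z + 1) ^+ #|T'| * #|run l0.+1 T'|%:R.
Proof.
move=> l0T'.
have -> : e * ((z + 1) ^+ #|T'| + (z + 1) ^+ #|T'|.-1 *+ #|run l0.+1 T' :\ l0|) =
  \sum_(l in run l0.+1 T') \sum_(T : {set 'I_n} | (T \subset T') && (l \notin T))
     e * z ^+ #|T|.
  under eq_bigr => l _ do rewrite -mulr_sumr sum_subset_avoid_expr.
  rewrite -mulr_sumr (bigD1 l0) ?run_start //=; congr (_ * (_ + _)).
    by congr (_ ^+ #|pred_of_set _|); apply/esym/setDidPl; rewrite disjoint_sym disjoints1.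
  rewrite (eq_bigl (mem (run l0.+1 T' :\ l0))) => [|l]; last by rewrite !inE andbC.
  rewrite -sumr_const; apply: eq_bigr => l.
  rewrite !inE ltnS => /andP[ll0 /andP[l0l /forallP/(_ l)]].
  rewrite leqnn andbT ltn_neqAle l0l andbT => /implyP lT'.
  rewrite (cardsD1 l T') lT' //; apply: contraNneq ll0 => ll0.
  by apply/eqP/val_inj.
have -> : f * (z + 1) ^+ #|T'| * #|run l0.+1 T'|%:R =
  \sum_(l in run l0.+1 T') \sum_(T : {set 'I_n} | (T \subset T') && (l \notin T))
     f * z ^+ #|T| * #|run l.+1 T|%:R.
  rewrite (exchange_big_dep (fun T => T \subset T')) /=; last by move=> l T _ /andP[].
  rewrite -sum_subset_expr mulr_sumr mulr_suml; apply: eq_bigr => T TT'.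
  rewrite -(sum_run_cards TT' l0T') natr_sum mulr_sumr.
  by apply: eq_bigl => l; rewrite TT'.
rewrite -sumrB; apply: eq_bigr => l _; rewrite -sumrB; apply: eq_bigr => T _.
by rewrite mulrBr mulrCA !mulrA [z ^+ _ * e]mulrC.
Qed.

(** Closed form of the sum of mu(u, v) X^(rk u) over u, by [sum_clo_weight] and inversion. *)
Definition clo_weight (R : pzRingType) (X : R) v : R :=
  (X - 1) ^+ #|twos v| * (if last_one v == 0%N then 1 else X - #|chains v|%:R).

Lemma clo_weight_tw0 (R : pzRingType) (X : R) T : ord0 \notin T ->
  clo_weight X (tw 0 T) = (X - 1) ^+ #|T|.
Proof. by move=> T0; rewrite /clo_weight last_one_tw0 // eqxx mulr1 twos_tw. Qed.

Lemma clo_weight_twS (R : pzRingType) (X : R) l T : ord0 \notin T -> l \notin T ->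
  clo_weight X (tw l.+1 T) = (X - 1) ^+ #|T| * (X - #|run l.+1 T|%:R).
Proof.
by move=> T0 lT; rewrite /clo_weight last_one_twS // chains_twS // twos_tw.
Qed.

Lemma sub_positive T : (T \subset [set~ ord0]) = (ord0 \notin T).
Proof. by rewrite subsetC sub1set inE. Qed.

Lemma sum_clo_weight (R : comPzRingType) (X : R) v :
  X ^+ size_can v = \sum_(u : CLO (triword n) | (u <= v)%O) clo_weight X u.
Proof.
rewrite big_mkcond (sum_triwords (fun u => if (u <= v :> CLO (triword n))%O then clo_weight X u else 0)).
have vD : twos v \subset [set~ ord0] by rewrite sub_positive twos0.
transitivity (X ^+ #|twos v| + \sum_(l in chains v)
    \sum_(T : {set 'I_n} | (T \subset twos v) && (l \notin T))
       (X - 1) ^+ #|T| * (X - 1 * #|run l.+1 T|%:R)); last first.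
  congr (_ + _).
    rewrite -[in LHS](subrK 1 X) -sum_subset_expr big_mkcond [RHS]big_mkcond.
    apply: eq_bigr => T _; case: ifP => [Tv|nTv].
      have TD := subset_trans Tv vD; rewrite TD.
      by rewrite sub_positive in TD; rewrite clo_le_tw0 // Tv clo_weight_tw0.
    case: ifP => // TD; rewrite sub_positive in TD.
    by rewrite clo_le_tw0 // nTv.
  rewrite big_mkcond; apply: eq_bigr => l _.
  case: ifP => lv.
    rewrite big_mkcond [RHS]big_mkcond; apply: eq_bigr => T _.
    case: (boolP (l \in T)) => lT; rewrite ?andbF //= !andbT.
    case: ifP => [Tv|nTv].
      have TD := subset_trans Tv vD; rewrite TD.
      by rewrite sub_positive in TD; rewrite clo_le_twS // Tv lv clo_weight_twS // mul1r.
    case: ifP => // TD; rewrite sub_positive in TD.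
    by rewrite clo_le_twS // nTv.
  apply/esym/big1 => T /andP[]; rewrite sub_positive => T0 lT.
  by rewrite clo_le_twS // lv andbF.
rewrite /size_can; have [v0|] := posnP (last_one v).
  by rewrite /chains v0 /= big_set0 addr0 addn0.
move=> m0; have [l0 El _] := last_oneP m0.
rewrite /chains El /= sum_subset_runs ?last_one_twos // subrK addn1.
set r := run _ _; have rE : #|r| = #|r :\ l0|.+1 by rewrite (cardsD1 l0) run_start.
(* With t the number of 2s and m the size of [r :\ l0], the term m X X^(t-1) must equal m X^t: for m
   = 0 trivially, otherwise because t > 0. *)
rewrite rE exprS; have [r0|r0] := posnP #|r :\ l0|.
  by rewrite r0; ring.
have Tpos : (0 < #|twos v|)%N.
  case/card_gt0P: r0 => l; rewrite !inE => /andP[ll0 /andP[l0l /forallP/(_ l)]].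
  rewrite leqnn andbT ltn_neqAle -ltnS l0l andbT => /implyP lT.
  apply/card_gt0P; exists l; apply: lT; apply: contraNneq ll0 => ll0.
  by apply/eqP/val_inj.
by case: #|twos v| Tpos => // k _; rewrite /= exprS; ring.
Qed.

Lemma M_triangleE (K : fieldType) (X Y : K) :
  M_triangle n X Y = \sum_v Y ^+ size_can v * clo_weight X v.
Proof.
rewrite /M_triangle exchange_big; apply: eq_bigr => v _ /=.
rewrite -(@mobius_inversion _ (CLO (triword n)) K _ _ (sum_clo_weight X)) mulr_sumr.
by apply: eq_bigr => u _; rewrite !clo_rank mulrC.
Qed.

(** The only label of a lower cover that is not an atom comes from a last 1 beyond the first
    position. *)
Lemma sum_partial_cores (K : comPzRingType) (x y : K) u :
  \sum_(A : {set triword n} | A \subset lower_covers u)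
      x ^+ (n - #|A| - neg_tilde u A) * y ^+ neg_tilde u A =
  x ^+ (n - size_can u) * ((1 + y) ^+ (#|twos u| + (last_one u == 1%N)) *
    (1 + x) ^+ (1 < last_one u)%N).
Proof.
pose at_ := [set c : triword n | label c u \in Atom n].
have cC : #|lower_covers u :&: at_| = neg u.
  by rewrite neg_lower_covers; apply: eq_card => c; rewrite !inE.
have cD : #|lower_covers u :\: at_| = (1 < last_one u)%N.
  rewrite cardsD cC card_lower_covers negE /size_can.
  by case: (last_one u) => [|[|k]]; lia.
have := @sum_subset_two_weights K _ n (lower_covers u) at_ x y.
rewrite cC cD card_lower_covers negE => /(_ (size_can_le u)) <-.
apply: eq_bigr => A _; rewrite -negE /neg_tilde.
rewrite (_ : [set u' in A | label u' u \in Atom n] = A :&: at_) //.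
by apply/setP => c; rewrite !inE.
Qed.

(** Summing over the encoded triwords turns the two sides into expressions in powers of z + 1 = s /
    y and w + 1 = s / x, where s = x + y + 1; a field identity then matches them. *)
Lemma F_triangle_partial_cores (K : fieldType) (x y : K) :
  x != 0 -> y != 0 -> y - x != 0 ->
  F_triangle n x y =
  \sum_u \sum_(A : {set triword n} | A \subset lower_covers u)
      x ^+ (n - #|A| - neg_tilde u A) * y ^+ neg_tilde u A.
Proof.
move=> x0 y0 yx0; rewrite /F_triangle M_triangleE.
set X := (y + 1) / (y - x); set Y := (y - x) / y.
(* The weight of a single 2: [z] on the left, and [w] on the right once x^n is factored out. *)
pose z := (x + 1) / y; pose w := (1 + y) / x.
have YX1 : Y * (X - 1) = z by rewrite /Y /X /z; field; rewrite y0.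
have YX : Y * X = (y + 1) / y by rewrite /Y /X; field; rewrite y0.
have cD : #|[set~ ord0 : 'I_n]| = N by rewrite cardsC1 card_ord.
(* This is the greatest triword (1, 2, .., 2), whose run is everything; so [sum_subset_runs] covers
   all triwords with a 1. *)
have runT : run (ord0 : 'I_n).+1 [set~ ord0 : 'I_n] = setT.
  apply/setP => l; rewrite !inE /=; apply/forallP => k.
  by apply/implyP => /andP[k0 _]; rewrite !inE; apply: contraTneq k0 => ->.
have -> : \sum_v Y ^+ size_can v * clo_weight X v = (z + 1) ^+ N +
    (Y * X * ((z + 1) ^+ N + (z + 1) ^+ N.-1 *+ N) - Y * (z + 1) ^+ N * n%:R).
  rewrite sum_triwords; congr (_ + _).
    rewrite -[in RHS]cD -sum_subset_expr; apply: eq_bigr => T.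
    rewrite sub_positive => T0; rewrite clo_weight_tw0 // /size_can.
    by rewrite last_one_tw0 // addn0 twos_tw // -exprMn YX1.
  have := @sum_subset_runs K [set~ ord0] ord0 z (Y * X) Y.
  rewrite runT cD cardsT card_ord (_ : #|[set: 'I_n] :\ ord0| = N); last first.
    by rewrite setTD cD.
  rewrite !inE eqxx => <- //; apply: eq_big => [l|l _]; first by rewrite inE.
  apply: eq_bigr => T /andP[]; rewrite sub_positive => T0 lT.
  rewrite clo_weight_twS // /size_can last_one_twS // twos_tw //= addn1 exprS.
  by rewrite -YX1 (exprMn _ Y (X - 1)); ring.
have -> : \sum_u \sum_(A : {set triword n} | A \subset lower_covers u)
      x ^+ (n - #|A| - neg_tilde u A) * y ^+ neg_tilde u A =
    x ^+ n * ((w + 1) ^+ N + (w * (w + 1) ^+ N +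
      (1 + x) / x * ((w + 1) ^+ N.-1 *+ N))).
  under eq_bigr => u _ do rewrite sum_partial_cores.
  have xB m : (m <= n)%N -> x ^+ (n - m) = x ^+ n * x^-1 ^+ m.
    by move=> mn; rewrite expfB_cond ?exprVn // (negPf x0).
  have leT T : T \subset [set~ ord0] -> (#|T| <= N)%N.
    by move/subset_leq_card; rewrite cD.
  rewrite sum_triwords mulrDr; congr (_ + _).
    rewrite -[in RHS]cD -sum_subset_expr mulr_sumr; apply: eq_bigr => T TD.
    have := TD; rewrite sub_positive => T0.
    rewrite /size_can last_one_tw0 // twos_tw //= !addn0 mulr1 xB ?leqW ?leT //.
    by rewrite -mulrA -exprMn [x^-1 * _]mulrC cD.
  (* A last 1 at the first position has an atom as label and weighs [w]; at any other position it
     weighs (1 + x) / x. *)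
  rewrite mulrDr (bigD1 ord0) //=; congr (_ + _).
    rewrite -[in RHS]cD -sum_subset_expr !mulr_sumr.
    apply: eq_big => [T|T /andP[TD _]]; first by rewrite sub_positive andbb.
    have := TD; rewrite sub_positive => T0.
    rewrite /size_can (@last_one_twS N ord0 T) // twos_tw //= mulr1 xB ?addn1 ?ltnS ?leT //.
    by rewrite -mulrA -exprMn [x^-1 * _]mulrC cD -[w * _]exprS.
  rewrite -[X in _ *+ X]cD -sumr_const mulr_sumr.
  rewrite mulr_sumr.
  apply: eq_big => [l|l l0]; first by rewrite !inE.
  have -> : N.-1 = #|[set~ ord0] :\ l|.
    by have := cardsD1 l [set~ ord0]; rewrite cD !inE l0; lia.
  rewrite -sum_subset_avoid_expr !mulr_sumr; apply: eq_bigr => T /andP[TD lT].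
  have := TD; rewrite sub_positive => T0.
  rewrite /size_can last_one_twS // twos_tw //.
  have -> : (1 < l.+1)%N by rewrite ltnS lt0n.
  have -> : (l.+1 == 1)%N = false by apply/negbTE; rewrite eqSS.
  rewrite xB ?addn1 ?ltnS ?leT // addn0 expr1 [x^-1 ^+ _]exprS /w exprMn.
  by ring.
have z1 : z + 1 = (x + y + 1) / y by rewrite /z; field.
have w1 : w + 1 = (x + y + 1) / x by rewrite /w; field.
(* For N = 0 the exponent [N.-1] is truncated, but its term has multiplicity 0. *)
rewrite YX z1 w1; case: N => [|M] /=.
  by rewrite /Y /w; field; rewrite x0.
rewrite !exprMn !exprVn !exprS.
have xM : x ^+ M != 0 by rewrite expf_neq0.
have yM : y ^+ M != 0 by rewrite expf_neq0.
by rewrite /Y /w; field; rewrite xM x0 yM.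
Qed.

End GeneratingFunctions.

Theorem proposition6p13 (n : nat) (n_gt0 : (0 < n)%N) :
  F_triangle n var_x var_y =
  \sum_(u : triword n)
    \sum_(A : {set triword n} | A \subset lower_covers u)
      var_x ^+ (n - #|A| - neg_tilde u A) * var_y ^+ neg_tilde u A.
Proof.
(* That x, y and y - x are nonzero is read off from a coefficient of degree one. *)
case: n n_gt0 => // N _; apply: F_triangle_partial_cores.
- rewrite tofrac_eq0; apply/eqP => /(congr1 (mcoeff U_(ord0))) /eqP.
  by rewrite mcoeffXU eqxx mcoeff0 oner_eq0.
- rewrite tofrac_eq0; apply/eqP => /(congr1 (mcoeff U_(ord_max))) /eqP.
  by rewrite mcoeffXU eqxx mcoeff0 oner_eq0.
- rewrite -tofracB tofrac_eq0; apply/eqP => /(congr1 (mcoeff U_(ord0))) /eqP.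
  by rewrite mcoeffB !mcoeffXU mcoeff0 eqxx sub0r oppr_eq0 oner_eq0.
Qed.
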